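(* There exists a finite quantum graph $\mathcal{Q}=(V,E,L,\mathbf{n})$ such that: - there are no loops, i.e. no edges joining a vertex to itself; - each vertex has degree $\ge3$; - the family $(L_e)_{e\in E}$ is rationally independent; and $\mathcal{Q}$ has a resonance on the real axis.
   Context: A quantum graph $\mathcal{Q}=(V,E,L,\mathbf{n})$ consists of a graph $(V,E)$, a length map $L:E\to(0,\infty)$, $L_e=L(e)$, and a map $\mathbf{n}:V\to\mathbb{N}\cup\{0\}$ ($\mathbf{n}(v)$ is the number of semi-infinite edges, called leads, attached to $v$). It is finite if $(V,E)$ is finite. The degree $d(v)$ is the number of edges in $E$ to which $v$ belongs. Rationally independent means linearly independent over $\mathbb{Q}$. $B$ is the set of oriented edges (bonds); $b\in B$ has origin $o(b)$, reverse $\hat b$ and length $L_b$ equal to that of the underlying edge. $B_{ext}=\{(v,k):v\in V,1\le k\le\mathbf{n}(v)\}$ with $o((v,k))=v$; $\hat B=B\cup B_{ext}$. $C^2(\mathcal{Q})$ is the set of families $f=(f_b)_{b\in\hat B}$ with $f_b\in C^2([0,L_b])$ for $b\in B$, $f_b\in C^2([0,\infty))$ for $b\in B_{ext}$, and $f_b(\cdot)=f_{\hat b}(L_b-\cdot)$ for $b\in B$. Such $f$ satisfies Kirchhoff conditions if $f_b(0)=f_{b'}(0)$ whenever $o(b)=o(b')$, and $\sum_{b\in\hat B:\,o(b)=v}f_b'(0)=0$ for all $v\in V$. A number $z\in\mathbb{C}$ is a (scattering) resonance of a finite quantum graph $\mathcal{Q}$ if there is a nonzero $f\in C^2(\mathcal{Q})$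 such that $f$ satisfies Kirchhoff conditions, $-f_b''=z^2f_b$ for all $b\in\hat B$, and $f_b(x)=f_b(0)e^{izx}$ for all $b\in B_{ext}$. *)

(* Defs.v *)
From HB Require Import structures.
From mathcomp Require Import all_boot all_order all_algebra.
From mathcomp Require Import all_classical all_reals all_analysis.
From mathcomp Require Import complex.
Set Implicit Arguments.
Unset Strict Implicit.
Unset Printing Implicit Defensive.
Import Order.TTheory GRing.Theory Num.Theory.
Import numFieldNormedType.Exports.
Local Open Scope classical_set_scope.
Local Open Scope ring_scope.
Local Open Scope complex_scope.

(* Calculus on a subset A of R, with A a nondegenerate interval in use: at a
   point of A the difference quotient is restricted to A, hence is one-sided at
   an endpoint.  [derive_on] is the limit when [derivable_on] holds. *)
Section CalculusOn.
Context {R : realType}.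

Definition quotient_on (g : R -> R) (x y : R) : R := (g y - g x) / (y - x).

Definition derivable_on (A : set R) (g : R -> R) : Prop :=
  forall x, A x -> cvg (quotient_on g x @ within A x^').

Definition derive_on (A : set R) (g : R -> R) (x : R) : R :=
  lim (quotient_on g x @ within A x^').

Definition C2_on (A : set R) (g : R -> R) : Prop :=
  [/\ derivable_on A g,
      derivable_on A (derive_on A g) &
      {within A, continuous (derive_on A (derive_on A g))}].

(* Complex-valued functions of a real variable, componentwise. *)
Definition C2c_on (A : set R) (g : R -> R[i]) : Prop :=
  C2_on A (fun x => complex.Re (g x)) /\ C2_on A (fun x => complex.Im (g x)).

Definition derivec_on (A : set R) (g : R -> R[i]) (x : R) : R[i] :=
  derive_on A (fun y => complex.Re (g y)) x
    +i* derive_on A (fun y => complex.Im (g y)) x.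

Definition expC (w : R[i]) : R[i] :=
  (expR (complex.Re w))%:C * (cos (complex.Im w) +i* sin (complex.Im w)).

End CalculusOn.

(* An edge is determined by the unordered pair of its endpoints, which may
   coincide.  The order of the pair [qends e] carries no information: it only
   serves to name the two orientations of [e], which must stay distinct even
   when [e] is a loop. *)
Record quantum_graph (R : realType) := QuantumGraph {
  qvert : finType;
  qedge : finType;
  qends : qedge -> qvert * qvert;
  qends_inj : forall e e' : qedge,
    [set (qends e).1; (qends e).2]%SET = [set (qends e').1; (qends e').2]%SET ->
    e = e';
  qlen : qedge -> R;
  qlen_gt0 : forall e, 0 < qlen e;
  qleads : qvert -> nat
}.

Section QuantumGraph.
Context {R : realType} (Q : quantum_graph R).

Definition belongs (v : qvert Q) (e : qedge Q) : bool :=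
  (v == (qends e).1) || (v == (qends e).2).

Definition degree (v : qvert Q) : nat := #|[pred e | belongs v e]|.

Definition is_loop (e : qedge Q) : bool := (qends e).1 == (qends e).2.

Definition rationally_independent : Prop :=
  forall q : qedge Q -> rat,
    \sum_(e : qedge Q) ratr (q e) * qlen e = 0 -> forall e, q e = 0.

Definition adjacent : rel (qvert Q) :=
  fun u v => [exists e : qedge Q, [&& belongs u e, belongs v e & u != v]].

Definition connected_graph : Prop := forall u v, connect adjacent u v.

(* The bond (e, false) starts at (qends e).1, the bond (e, true) at
   (qends e).2. *)
Definition bond : finType := (qedge Q * bool)%type.

Definition brev (b : bond) : bond := (b.1, ~~ b.2).

Definition blen (b : bond) : R := qlen b.1.

(* The leads at v are numbered from 0. *)
Definition lead : finType := {v : qvert Q & 'I_(qleads v)}.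

Definition ebond : finType := (bond + lead)%type.

Definition origin (b : ebond) : qvert Q :=
  match b with
  | inl (e, o) => if o then (qends e).2 else (qends e).1
  | inr l => tag l
  end.

Definition bdom (b : ebond) : set R :=
  match b with
  | inl b => `[0, blen b]
  | inr _ => `[0, +oo[
  end.

(* Families are given by functions on the whole of R; only the values of f b on
   [bdom b] are ever used. *)
Definition C2_graph (f : ebond -> R -> R[i]) : Prop :=
  (forall b : ebond, C2c_on (bdom b) (f b)) /\
  (forall (b : bond) (x : R), bdom (inl b) x ->
     f (inl b) x = f (inl (brev b)) (blen b - x)).

Definition nonzero_family (f : ebond -> R -> R[i]) : Prop :=
  exists (b : ebond) (x : R), bdom b x /\ f b x <> 0.

Definition kirchhoff (f : ebond -> R -> R[i]) : Prop :=
  (forall b b' : ebond, origin b = origin b' -> f b 0 = f b' 0) /\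
  (forall v : qvert Q,
     \sum_(b : ebond | origin b == v) derivec_on (bdom b) (f b) 0 = 0).

Definition resonance (z : R[i]) : Prop :=
  exists f : ebond -> R -> R[i],
    [/\ C2_graph f,
        nonzero_family f,
        kirchhoff f,
        forall (b : ebond) (x : R), bdom b x ->
          - derivec_on (bdom b) (derivec_on (bdom b) (f b)) x = z ^+ 2 * f b x &
        forall (l : lead) (x : R), bdom (inr l) x ->
          f (inr l) x = f (inr l) 0 * expC ((0 +i* 1) * z * x%:C)].

End QuantumGraph.

(* Main.v *)
(* The graph is K_4 with one lead, at vertex 0, and the resonance is z = 1.  On
   an edge of length L = 2 atan s the solutions of f'' = - f are determined by
   their values at the endpoints (sin L <> 0), and cos L, sin L are rational
   functions of s, so the Kirchhoff conditions become linear equations in the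
   vertex values with coefficients in Q(s).  The vertex values 0, 1, 1, -1 solve
   them for
     s_01 = 3/4, s_02 = 3/2, s_03 = 4, s_12 = 7/8, s_13 = 12/7, s_23 = 24/31,
   and the resulting function extends by 0 to the lead because it vanishes at
   vertex 0.
   The length of an edge with s = p/q is 2 arg(q + p i), and the six norms
   p^2 + q^2 = 5^2, 13, 17, 113, 193, 29 * 53 are pairwise coprime, so a rational
   relation between the lengths, that is, a real product of powers of the
   q +- p i, is excluded by reducing modulo one prime divisor of each norm. *)
Require Import Defs.
From mathcomp Require Import all_boot all_order all_algebra.
From mathcomp Require Import all_classical all_reals all_analysis.
From mathcomp Require Import complex ring lra.
Set Implicit Arguments.
Unset Strict Implicit.
Unset Printing Implicit Defensive.
Import Order.TTheory GRing.Theory Num.Theory.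
Import numFieldNormedType.Exports.
Local Open Scope classical_set_scope.
Local Open Scope ring_scope.
Local Open Scope complex_scope.

(** * Rational independence of arctangents of rationals, by reduction modulo primes *)

Lemma sin_atan (R : realType) (x : R) : sin (atan x) = x * cos (atan x).
Proof.
have c0 : cos (atan x) != 0.
  by rewrite cos_atan invr_neq0 // gt_eqF // sqrtr_gt0 ltr_pwDl ?ltr01 ?sqr_ge0.
by rewrite -[LHS](divfK c0); congr (_ * _); exact: atanK.
Qed.

(* For some Gaussian integer a + b i of argument t, the elements u and v are its
   images under i |-> r and i |-> - r, where r is a square root of -1 in K. *)
Definition gauss_angle {R : realType} {K : fieldType} (r : K) (t : R) (u v : K) :=
  exists (a b : int) (rho : R), [/\ 0 < rho,
    a%:~R = rho * cos t, b%:~R = rho * sin t,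
    u = a%:~R + b%:~R * r & v = a%:~R - b%:~R * r].

Section GaussAngle.
Context {R : realType} {K : fieldType} {r : K} (r2 : r ^+ 2 = -1).
Implicit Types (t : R) (u v : K).

Lemma gauss_angle0 : gauss_angle r (0 : R) 1 1.
Proof.
exists 1, 0, 1; rewrite cos0 sin0 !mulr0 mulr1.
by split; rewrite ?ltr01 // mul0r ?addr0 ?subr0.
Qed.

Lemma gauss_angleN t u v : gauss_angle r t u v -> gauss_angle r (- t) v u.
Proof.
case=> a [b [rho [rho0 aE bE -> ->]]].
exists a, (- b), rho; rewrite cosN sinN mulrN -bE !rmorphN /= mulNr opprK.
by split.
Qed.

Lemma gauss_angleD t t' u u' v v' : gauss_angle r t u v ->
  gauss_angle r t' u' v' -> gauss_angle r (t + t') (u * u') (v * v').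
Proof.
move=> [a [b [rho [rho0 aE bE -> ->]]]] [a' [b' [rho' [rho'0 a'E b'E -> ->]]]].
exists (a * a' - b * b'), (a * b' + b * a'), (rho * rho').
rewrite cosD sinD !rmorphB !rmorphD !rmorphM /= aE bE a'E b'E mulr_gt0 //.
split=> //; [by ring|by ring| |];
  by rewrite -(mulN1r (b%:~R * b'%:~R)) -r2; ring.
Qed.

Lemma gauss_angleMn n t u v :
  gauss_angle r t u v -> gauss_angle r (t *+ n) (u ^+ n) (v ^+ n).
Proof.
move=> h; elim: n => [|n IHn]; first by rewrite !expr0 mulr0n; exact: gauss_angle0.
by rewrite mulrS !exprS; exact: gauss_angleD.
Qed.

Lemma gauss_angle_atan (p q : nat) : (0 < q)%N ->
  gauss_angle r (atan (p%:R / q%:R : R)) (q%:R + p%:R * r) (q%:R - p%:R * r).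
Proof.
move=> q0; have qR : (0 : R) < q%:R by rewrite ltr0n.
set s := p%:R / q%:R; have w0 : 0 < Num.sqrt (1 + s ^+ 2).
  by rewrite sqrtr_gt0 ltr_pwDl ?ltr01 ?sqr_ge0.
have cE : cos (atan s) = (Num.sqrt (1 + s ^+ 2))^-1 by exact: cos_atan.
exists (Posz q), (Posz p), (q%:R * Num.sqrt (1 + s ^+ 2)).
rewrite sin_atan cE; split; rewrite ?mulr_gt0 //.
- by rewrite -mulrA divff ?gt_eqF ?mulr1.
- by rewrite mulrACA divff ?gt_eqF // mulr1 mulrC /s divfK ?gt_eqF.
Qed.

Lemma gauss_angle_sum (I : finType) (t : I -> R) (u v : I -> K) :
  (forall i, gauss_angle r (t i) (u i) (v i)) ->
  gauss_angle r (\sum_i t i) (\prod_i u i) (\prod_i v i).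
Proof.
move=> h; apply: (big_ind3 (gauss_angle r)) => //; first exact: gauss_angle0.
by move=> *; exact: gauss_angleD.
Qed.

(** Angle 0 makes the Gaussian integer real, so its two images agree. This turns a vanishing sum of
    angles into an equation in [K]. *)
Lemma gauss_angle_zero u v : gauss_angle r (0 : R) u v -> u = v.
Proof.
case=> a [b [rho [_ _]]]; rewrite sin0 mulr0 => /eqP; rewrite intr_eq0 => /eqP -> -> ->.
by rewrite mul0r addr0 subr0.
Qed.

End GaussAngle.

(** A vanishing combination equates two conjugate products in ['F_P]. The root of -1 is chosen to
    kill one conjugate at [i0] and no other factor, so [n i0 != 0] would make exactly one product
    zero. *)
Lemma atan_int_combination_eq0 (R : realType) (I : finType) (p q : I -> nat)
    (n : I -> int) (P : nat) (i0 : I) :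
  (forall i, 0 < q i)%N -> prime P -> odd P -> ~~ (P %| p i0)%N ->
  (P %| p i0 ^ 2 + q i0 ^ 2)%N ->
  (forall i, i != i0 -> ~~ (P %| p i ^ 2 + q i ^ 2)%N) ->
  \sum_i (n i)%:~R * atan ((p i)%:R / (q i)%:R) = 0 :> R -> n i0 = 0.
Proof.
move=> q0 Ppr Podd pP PN PN' sum0.
have chP := pchar_Fp Ppr.
have p0 : (p i0)%:R != 0 :> 'F_P by rewrite -(dvdn_pcharf chP).
have two0 : 2%:R != 0 :> 'F_P.
  rewrite -(dvdn_pcharf chP); apply: contraL Podd => /dvdn_leq => /(_ isT).
  by case: P Ppr {pP PN PN' chP p0} => [|[|[|]]].
have N0 : (p i0)%:R ^+ 2 + (q i0)%:R ^+ 2 = 0 :> 'F_P.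
  by rewrite -!natrX -natrD; apply/eqP; rewrite -(dvdn_pcharf chP).
pose r : 'F_P := - (q i0)%:R / (p i0)%:R.
have r2 : r ^+ 2 = -1.
  rewrite /r expr_div_n sqrrN; apply: (canLR (mulfK _)); first exact: expf_neq0.
  by apply/eqP; rewrite mulN1r -addr_eq0 addrC N0.
have u0 : (q i0)%:R + (p i0)%:R * r = 0 by rewrite /r mulrC divfK // subrr.
have v0 : (q i0)%:R - (p i0)%:R * r != 0.
  rewrite /r [_ * (_ / _)]mulrC divfK // opprK.
  rewrite (_ : _ + _ = 2%:R * (q i0)%:R); last by ring.
  rewrite mulf_neq0 //.
  apply: contra_eq_neq N0 => ->; rewrite expr0n addr0; exact: expf_neq0.
(* The product of the two conjugates is the norm, which is nonzero modulo [P] away from [i0]. *)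
have uv i : i != i0 ->
    ((q i)%:R + (p i)%:R * r != 0) && ((q i)%:R - (p i)%:R * r != 0).
  move=> /PN'; rewrite (dvdn_pcharf chP) natrD !natrX -negb_or -mulf_eq0.
  congr (~~ (_ == 0)).
  transitivity ((q i)%:R ^+ 2 - (p i)%:R ^+ 2 * r ^+ 2); last by ring.
  by rewrite r2; ring.
(* The sign of n i goes into the choice of the conjugate, since the factor at i0
   may be 0 and has no negative powers. *)
pose e b i : 'F_P := (q i)%:R + (-1) ^+ (b (+) (n i < 0)) * ((p i)%:R * r).
have := @gauss_angle_sum R _ r r2 I (fun i => (n i)%:~R * atan ((p i)%:R / (q i)%:R))
  (fun i => e false i ^+ `|n i|%N) (fun i => e true i ^+ `|n i|%N).
rewrite sum0 => /(_ _)/gauss_angle_zero; rewrite /e /= => H.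
have {}H : \prod_i e false i ^+ `|n i|%N = \prod_i e true i ^+ `|n i|%N.
  apply: H => i; have h := gauss_angleMn r2 `|n i|%N (gauss_angle_atan (R := R) (r := r) (p i) (q0 i)).
  case: (ltP (n i) 0) => ni; rewrite /= expr0 expr1 mul1r mulN1r.
    rewrite -[in (n i)%:~R](opprK (n i)) -(ltz0_abs ni) rmorphN mulNr /=.
    by apply: gauss_angleN; rewrite mulrzl.
  by rewrite -[in (n i)%:~R](gez0_abs ni) mulrzl.
have e0 b : (e b i0 == 0) = ~~ (b (+) (n i0 < 0)).
  rewrite /e; case: (b (+) _); first by rewrite expr1 mulN1r (negPf v0).
  by rewrite expr0 mul1r u0 eqxx.
have eN b i : i != i0 -> e b i != 0.
  by move=> /uv/andP[]; rewrite /e; case: (b (+) _) => ? ?; rewrite ?expr1 ?expr0 ?mulN1r ?mul1r.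
apply/eqP/negPn/negP; rewrite -absz_eq0 -lt0n => n0.
(* Only the factor at [i0] can vanish; the sign of [n i0] decides in which of the two products. *)
have prod0 b : (\prod_i e b i ^+ `|n i|%N == 0) = ~~ (b (+) (n i0 < 0)).
  rewrite -e0 (bigD1 i0) //= mulf_eq0 expf_eq0 n0 /= [X in _ || X]negbTE ?orbF //.
  by apply/prodf_neq0 => i /eN ?; rewrite expf_neq0.
have := congr1 (eq_op^~ 0) H; rewrite /= !prod0.
by case: (_ < _).
Qed.

Lemma atan_rationally_independent (R : realType) (I : finType)
    (p q P : I -> nat) (c : I -> rat) :
  (forall i, 0 < q i)%N -> (forall i, prime (P i)) -> (forall i, odd (P i)) ->
  (forall i, ~~ (P i %| p i)%N) ->
  (forall i j, (P i %| p j ^ 2 + q j ^ 2)%N = (j == i)) ->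
  \sum_i ratr (c i) * atan ((p i)%:R / (q i)%:R) = 0 :> R -> forall i, c i = 0.
Proof.
move=> q0 Ppr Podd Pp PN sum0 i.
pose D : int := \prod_j denq (c j).
(* This is [D * c j], written without division so that it is visibly an integer. *)
pose n j : int := numq (c j) * \prod_(k | k != j) denq (c k).
have nE j : (n j)%:~R = D%:~R * ratr (c j) :> R.
  rewrite /n /D [in RHS](bigD1 j) //= !intrM mulrAC; congr (_ * _).
  by rewrite /ratr mulrC divfK // intr_eq0 denq_neq0.
have : n i = 0.
  apply: (@atan_int_combination_eq0 R I p q n (P i) i) => //.
  - by rewrite PN.
  - by move=> j ji; rewrite PN.
  - under eq_bigr do rewrite nE -mulrA.
    by rewrite -mulr_sumr sum0 mulr0.
move=> /eqP; rewrite mulf_eq0 => /orP[|]; first by rewrite numq_eq0 => /eqP.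
by apply/contraTeq => _; apply/prodf_neq0 => k _; exact: denq_neq0.
Qed.

(** * Derivatives within an interval, and the solutions of f'' = - f *)

(** Points of the segment from [x] towards [y] lie in [A] and approach [x]. Properness makes limits
    unique, so that [derive_on] can be computed. *)
Lemma within_dnbhs_itv_proper (R : realType) (A : set R) (x y : R) :
  is_interval A -> A x -> A y -> x != y -> ProperFilter (within A x^').
Proof.
move=> itvA Ax Ay xy; split; last exact: within_filter.
rewrite /within /= /dnbhs /within /= => /nbhs_ballP[e /= e0 /= xe].
(* The bound 1 keeps [w] between [x] and [y]; the other bound keeps it within [e / 2] of [x]. *)
pose t := Num.min 1 (e / 2 / `|y - x|).
have yx0 : 0 < `|y - x| by rewrite normr_gt0 subr_eq0 eq_sym.
have t0 : 0 < t by rewrite lt_min ltr01 /= !divr_gt0.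
have t1 : t <= 1 by rewrite ge_min lexx.
pose w := x + t * (y - x).
have wx : w - x = t * (y - x) by rewrite /w; ring.
apply: (xe w).
- rewrite /ball /= distrC wx normrM (gtr0_norm t0).
  apply: (@le_lt_trans _ _ (e / 2)); last by rewrite ltr_pdivrMr // mulr_natr mulr2n ltrDr.
  by rewrite -ler_pdivlMr // ge_min lexx orbT.
- by rewrite -subr_eq0 wx mulf_neq0 ?(gt_eqF t0) // subr_eq0 eq_sym.
- have [xly|yltx] := leP x y.
  + by apply: (itvA x y) => //; apply/andP; split; rewrite /w; nra.
  + by apply: (itvA y x) => //; apply/andP; split; rewrite /w; nra.
Qed.

Section DeriveOn.
Context {R : realType} (A : set R).
Hypothesis A_proper : forall x, A x -> ProperFilter (within A x^').
Implicit Types (g h : R -> R) (x d : R).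

(** Restricting punctured neighbourhoods to [A] refines the filter, so the two-sided limit is
    inherited, at endpoints too. *)
Lemma quotient_on_cvg g x d :
  is_derive x (1 : R) g d -> quotient_on g x y @[y --> within A x^'] --> d.
Proof.
move=> [dg <-].
have shiftx : (fun y => y - x) @ x^' --> (0 : R)^'.
  move=> B; rewrite /dnbhs /within /= => /nbhs_ballP[e /= e0 eB].
  apply/nbhs_ballP; exists e => //= y xy yx; apply: eB.
    by rewrite /ball /= sub0r opprB; move: xy; rewrite /ball /=.
  by rewrite subr_eq0.
have := cvg_comp _ _ shiftx dg.
move=> /(cvg_trans _); apply; apply: cvg_trans (cvg_app _ (cvg_within _ )) _.
apply: near_eq_cvg; near=> y.
by rewrite /= /quotient_on scaler1 subrK mulrC.
Unshelve. all: by end_near. Qed.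

Lemma derive_onE g x d : A x -> is_derive x (1 : R) g d -> derive_on A g x = d.
Proof.
move=> Ax dg; have FF := A_proper Ax.
by apply: cvg_lim => //; exact: quotient_on_cvg.
Qed.

Lemma quotient_on_eq g h x : {in A, g =1 h} -> A x ->
  quotient_on g x @ within A x^' = quotient_on h x @ within A x^'.
Proof.
move=> gh Ax.
have W : forall g h, {in A, g =1 h} ->
    quotient_on g x @ within A x^' `=>` quotient_on h x @ within A x^'.
  move=> g' h' g'h'; apply: fmap_within_eq => y /[!inE] Ay.
  by rewrite /quotient_on !g'h' ?inE.
by apply/seteqP; split => B /W; apply => z /gh.
Qed.

Lemma derive_on_eq g h x : {in A, g =1 h} -> A x ->
  derive_on A g x = derive_on A h x.
Proof. by move=> gh Ax; rewrite /derive_on (quotient_on_eq gh). Qed.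

Lemma derivable_on_eq g h : {in A, g =1 h} -> derivable_on A h -> derivable_on A g.
Proof. by move=> gh dh x Ax; rewrite (quotient_on_eq gh) //; exact: dh. Qed.

(** The general real solution of f'' = - f, parametrized by its value and slope at 0;
    differentiation acts by (a, b) -> (b, - a). *)
Definition sinusoid (a b x : R) : R := a * cos x + b * sin x.

Lemma is_derive_sinusoid (a b x : R) :
  is_derive x (1 : R) (sinusoid a b) (sinusoid b (- a) x).
Proof.
rewrite /sinusoid.
apply: is_derive_eq.
by rewrite /GRing.scale /=; ring.
Qed.

Lemma derive_on_sinusoid (a b : R) :
  {in A, derive_on A (sinusoid a b) =1 sinusoid b (- a)}.
Proof. by move=> x /[!inE] Ax; apply: derive_onE => //; exact: is_derive_sinusoid. Qed.

Lemma derive2_on_sinusoid (a b : R) :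
  {in A, derive_on A (derive_on A (sinusoid a b)) =1 sinusoid (- a) (- b)}.
Proof.
move=> x xA; have Ax : A x by rewrite inE in xA.
by rewrite (derive_on_eq (derive_on_sinusoid _ _)) // derive_on_sinusoid.
Qed.

Lemma derivable_on_sinusoid (a b : R) : derivable_on A (sinusoid a b).
Proof.
move=> x Ax; apply/cvg_ex; exists (sinusoid b (- a) x).
by apply: quotient_on_cvg; exact: is_derive_sinusoid.
Qed.

Lemma continuous_sinusoid (a b : R) : continuous (sinusoid a b).
Proof.
move=> x; apply: cvgD; apply: cvgM; do ?[exact: cvg_cst].
- exact: continuous_cos.
- exact: continuous_sin.
Qed.

Lemma C2_on_sinusoid (a b : R) : C2_on A (sinusoid a b).
Proof.
split; first exact: derivable_on_sinusoid.
  apply: (derivable_on_eq (h := sinusoid b (- a))).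
    exact: derive_on_sinusoid.
  exact: derivable_on_sinusoid.
apply: (@subspace_eq_continuous _ _ _ (sinusoid (- a) (- b))).
  by move=> x xA; apply/esym; exact: derive2_on_sinusoid.
by apply: continuous_subspaceT; exact: continuous_sinusoid.
Qed.

End DeriveOn.

(** * From vertex values to a resonance at 1 *)

Lemma cos_sin_double_atan (R : realType) (x : R) :
  cos (2 * atan x) = (1 - x ^+ 2) / (1 + x ^+ 2) /\
  sin (2 * atan x) = 2 * x / (1 + x ^+ 2).
Proof.
have x0 : 1 + x ^+ 2 != 0 by rewrite gt_eqF // ltr_pwDl ?ltr01 ?sqr_ge0.
have cE : cos (atan x) ^+ 2 = (1 + x ^+ 2)^-1.
  by rewrite cos_atan exprVn sqr_sqrtr // addr_ge0 ?ler01 ?sqr_ge0.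
rewrite !mulr_natl cos_mulr2n sin_mulr2n sin_atan mulrCA -expr2 cE.
by split; field.
Qed.

Section VertexValues.
Context {R : realType} (Q : quantum_graph R).
Variables (s : qedge Q -> R) (F : qvert Q -> R).
Hypothesis s_gt0 : forall e, 0 < s e.
Hypothesis qlenE : forall e, qlen e = 2 * atan (s e).

Definition terminus (b : bond Q) : qvert Q := origin (inl (brev b)).

(* The derivative at 0 of the solution of f'' = - f on [0, qlen e] with the
   boundary values prescribed by F, with s e = tan (qlen e / 2). *)
Definition bond_slope (b : bond Q) : R :=
  (F (terminus b) * (1 + s b.1 ^+ 2) - F (origin (inl b)) * (1 - s b.1 ^+ 2))
    / (2 * s b.1).

Definition vertex_wave (b : ebond Q) : R -> R :=
  sinusoid (F (origin b)) (if b is inl b' then bond_slope b' else 0).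

Lemma bdom_proper (b : ebond Q) x :
  bdom b x -> ProperFilter (within (bdom b) x^').
Proof.
have [y [z [By Bz yz]]] : exists y z, [/\ bdom b y, bdom b z & y != z].
  case: b => [b|l].
    exists 0, (blen b); rewrite /= !in_itv/= !lexx !ltW ?qlen_gt0 //.
    by split=> //; rewrite lt_eqF // qlen_gt0.
  by exists 0, 1; rewrite /= !in_itv/= !andbT lexx ler01 eq_sym oner_neq0.
have itvB : is_interval (bdom b) by case: (b) => ?; exact: interval_is_interval.
move=> Bx; have [xy|xy] := eqVneq x y.
  by apply: (@within_dnbhs_itv_proper _ _ _ z) => //; rewrite xy.
exact: (@within_dnbhs_itv_proper _ _ _ y).
Qed.

(** Expanding cos (L - x) and sin (L - x) leaves an identity linear in cos x and sin x, whose
    coefficients are rational in [s]. *)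
Lemma vertex_wave_brev (b : bond Q) x :
  vertex_wave (inl b) x = vertex_wave (inl (brev b)) (blen b - x).
Proof.
have s0 := s_gt0 b.1.
have s1 : 1 + s b.1 ^+ 2 != 0 by rewrite gt_eqF // ltr_pwDl ?ltr01 ?sqr_ge0.
have [cE sE] := cos_sin_double_atan (s b.1).
rewrite /vertex_wave /sinusoid /bond_slope /terminus.
have -> : brev (brev b) = b by case: (b) => e o; rewrite /brev /= negbK.
rewrite [(brev b).1]/= /blen qlenE cosB sinB cE sE.
by field; rewrite s1 gt_eqF.
Qed.

(** Waves are continuous at vertices by construction, so Kirchhoff reduces to the slope sums. Since
    [F] vanishes where leads are attached, the wave is 0 on them and the outgoing condition is
    trivial. *)
Lemma resonance1_of_vertex_values :
  (exists b : bond Q, F (origin (inl b)) != 0) ->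
  (forall l : lead Q, F (tag l) = 0) ->
  (forall v, \sum_(b : bond Q | origin (inl b) == v) bond_slope b = 0) ->
  resonance Q 1%:C.
Proof.
move=> [b0 F0] Flead Fsum.
(* The imaginary parts are zero; as a sinusoid, 0 falls under the same lemmas as the real parts. *)
have zeroE : (fun=> 0) = sinusoid 0 0 :> (R -> R).
  by apply/funext => x; rewrite /sinusoid !mul0r addr0.
have lead0 l x : vertex_wave (inr l) x = 0.
  by rewrite /vertex_wave /= Flead -zeroE.
have wave0 b : vertex_wave b 0 = F (origin b).
  by rewrite /vertex_wave /sinusoid cos0 sin0 mulr1 mulr0 addr0.
exists (fun b x => (vertex_wave b x)%:C); split.
- split=> [b|b x _]; last by rewrite vertex_wave_brev.
  split; first exact: (C2_on_sinusoid (@bdom_proper b)).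
  by rewrite /= zeroE; exact: (C2_on_sinusoid (@bdom_proper b)).
- exists (inl b0), 0; split; first by rewrite /= in_itv/= lexx ltW // qlen_gt0.
  by rewrite wave0 => -[/eqP]; rewrite (negPf F0).
- split=> [b b' obb'|v]; first by rewrite !wave0 obb'.
  have dE (b : ebond Q) : derivec_on (bdom b) (fun x => (vertex_wave b x)%:C) 0
      = (if b is inl b' then bond_slope b' else 0)%:C.
    have b0in : 0 \in bdom b.
      by case: (b) => [b'|l]; rewrite inE /= in_itv/= lexx // ltW // qlen_gt0.
    rewrite /derivec_on /= zeroE !(derive_on_sinusoid (@bdom_proper b)) //.
    by rewrite /sinusoid cos0 sin0 !(mulr0, mulr1, addr0).
  under eq_bigr do rewrite dE.
  rewrite -rmorph_sum /= big_sumType /= [X in _ + X]big1 ?addr0 //.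
  by rewrite Fsum.
- move=> b x /mem_set xin.
  rewrite /derivec_on /= zeroE !(derive2_on_sinusoid (@bdom_proper b)) //.
  rewrite !oppr0 -zeroE rmorph1 expr1n mul1r /vertex_wave /sinusoid.
  by apply/eqP; rewrite eq_complex /= oppr0 eqxx andbT !mulNr -opprD opprK.
- by move=> l x _; rewrite !lead0 mul0r.
Qed.

End VertexValues.

(** * The weighted graph K_4 *)

Definition k4_end (i : 'I_6) : 'I_4 * 'I_4 :=
  nth (inZp 0, inZp 0)
    [:: (inZp 0, inZp 1); (inZp 0, inZp 2); (inZp 0, inZp 3);
        (inZp 1, inZp 2); (inZp 1, inZp 3); (inZp 2, inZp 3)] i.

Definition k4_num (i : 'I_6) : nat := nth 0%N [:: 3; 3; 4; 7; 12; 24]%N i.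
Definition k4_den (i : 'I_6) : nat := nth 1%N [:: 4; 2; 1; 8; 7; 31]%N i.
Definition k4_prime (i : 'I_6) : nat := nth 0%N [:: 5; 13; 17; 113; 193; 29]%N i.

Lemma k4_end_inj (e e' : 'I_6) :
  [set (k4_end e).1; (k4_end e).2]%SET = [set (k4_end e').1; (k4_end e').2]%SET ->
  e = e'.
Proof.
move=> /setP E; apply: val_inj.
(* Membership of each of the four vertices determines the edge, which leaves a finite check. *)
move: (E (inZp 0)) (E (inZp 1)) (E (inZp 2)) (E (inZp 3)); rewrite !inE.
by case: e {E} => [[|[|[|[|[|[|]]]]]]] //= ?; case: e' => [[|[|[|[|[|[|]]]]]]].
Qed.

Lemma k4_den_gt0 i : (0 < k4_den i)%N.
Proof. by case: i => [[|[|[|[|[|[|]]]]]]]. Qed.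

Lemma k4_num_gt0 i : (0 < k4_num i)%N.
Proof. by case: i => [[|[|[|[|[|[|]]]]]]]. Qed.

Definition k4_tan (R : realType) (i : 'I_6) : R :=
  (k4_num i)%:R / (k4_den i)%:R.

Lemma k4_tan_gt0 (R : realType) i : 0 < k4_tan R i.
Proof. by rewrite divr_gt0 // ltr0n ?k4_num_gt0 ?k4_den_gt0. Qed.

Lemma k4_len_gt0 (R : realType) i : 0 < 2 * atan (k4_tan R i).
Proof. by rewrite mulr_gt0 // -(atan0 R) lt_atan // k4_tan_gt0. Qed.

Definition k4_graph (R : realType) : quantum_graph R :=
  QuantumGraph k4_end_inj (k4_len_gt0 R) (fun v : 'I_4 => (v == ord0) : nat).

Lemma k4_rationally_independent (R : realType) :
  rationally_independent (k4_graph R).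
Proof.
move=> c /= sum0; apply: (@atan_rationally_independent R _ k4_num k4_den k4_prime).
- exact: k4_den_gt0.
- by case=> [[|[|[|[|[|[|]]]]]]].
- by case=> [[|[|[|[|[|[|]]]]]]].
- by case=> [[|[|[|[|[|[|]]]]]]].
- by case=> [[|[|[|[|[|[|]]]]]]] //= ? [[|[|[|[|[|[|]]]]]]].
- apply: (mulfI (_ : 2 != 0)) => //.
  by rewrite mulr0 -[RHS]sum0 mulr_sumr; apply: eq_bigr => i _; rewrite mulrCA.
Qed.

Lemma k4_degree (R : realType) (v : qvert (k4_graph R)) : degree v = 3.
Proof.
rewrite /degree -sum1_card big_mkcond /= !big_ord_recl big_ord0 /belongs /=.
by case: v => [[|[|[|[|]]]]].
Qed.

Lemma k4_connected (R : realType) : connected_graph (k4_graph R).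
Proof.
move=> u v; have [->|uv] := eqVneq u v; first exact: connect0.
apply: connect1; apply/existsP.
suff [e] : exists e : 'I_6, @belongs R (k4_graph R) u e && @belongs R (k4_graph R) v e.
  by move=> ?; exists e; rewrite andbA uv andbT.
move: u v uv; rewrite /belongs /=.
case=> [[|[|[|[|]]]]] //= ? [[|[|[|[|]]]]] //= ? _;
  solve [ by exists (inZp 0) | by exists (inZp 1) | by exists (inZp 2)
        | by exists (inZp 3) | by exists (inZp 4) | by exists (inZp 5)].
Qed.

Definition k4_value (R : realType) (v : 'I_4) : R := nth 0 [:: 0; 1; 1; -1] v.

Lemma k4_resonance1 (R : realType) : resonance (k4_graph R) 1%:C.
Proof.
apply: (@resonance1_of_vertex_values R (k4_graph R) (k4_tan R) (k4_value R)).
- exact: k4_tan_gt0.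
- by [].
(* This bond is the edge 01 traversed from vertex 1, where the value is 1. *)
- by exists ((inZp 0 : 'I_6), true); rewrite /k4_value /= oner_neq0.
- by case=> -[[|[|[|[|]]]] /= ?] [].
(* Summing over edges and then orientations makes each vertex condition an explicit identity between
   rational numbers. *)
move=> v; rewrite (_ : \sum_(b | _) _ = \sum_(e : 'I_6) \sum_(o : bool |
    @origin R (k4_graph R) (inl (e, o)) == v) @bond_slope R (k4_graph R) (k4_tan R) (k4_value R) (e, o));
    last by rewrite pair_big_dep /=; apply: eq_big => -[].
under eq_bigr do rewrite big_mkcond /= big_bool /=.
rewrite !big_ord_recl big_ord0 /bond_slope /k4_tan /k4_value /k4_num /k4_den /=.
case: v => [[|[|[|[|]]]]] //= ?.
all: by field.
Qed.

(** The added conclusions exclude trivial examples: constants give a resonance at 0, and a component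
    with edges but no leads has real eigenvalues. *)
Theorem proposition2 (R : realType) :
  exists Q : quantum_graph R,
    [/\ forall e : qedge Q, ~~ is_loop e,
        forall v : qvert Q, (3 <= degree v)%N,
        rationally_independent Q,
        connected_graph Q /\ (exists v : qvert Q, (0 < qleads v)%N) &
        exists x : R, x != 0 /\ resonance Q x%:C].
Proof.
exists (k4_graph R); split.
- by case=> [[|[|[|[|[|[|]]]]]]].
- by move=> v; rewrite k4_degree.
- exact: k4_rationally_independent.
- by split; [exact: k4_connected | exists ord0].
- by exists 1; split; [exact: oner_neq0 | exact: k4_resonance1].
Qed.
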